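(* Let $\mathcal{X}$ be a real Banach space and let $\mathcal{F}\subset\mathcal{X}$ be a compact set whose linear span is infinite dimensional. Let $\{f_n\}_{n\ge0}$, $\{g_n\}_{n\ge0}$, $\{\mathcal{R}_n\}_{n\ge0}$, $\{V_n\}_{n\ge0}$ be any realization of the Natural Greedy Algorithm for $\mathcal{F}$, with norming functionals $\{F_{g_n}\}_{n\ge0}$. Then (i) $F_{g_k}(\mathcal{R}_m(f))=0$ for all integers $m>k\ge0$ and all $f\in\mathcal{X}$; (ii) for every $n\ge0$, $\mathcal{R}_n:\mathcal{X}\to\mathcal{X}$ is a linear projector, i.e. $\mathcal{R}_n^2=\mathcal{R}_n$, with $\ker\mathcal{R}_n=V_n$.
   Context: A norming functional of $x\in\mathcal{X}\setminus\{0\}$ is $F_x\in\mathcal{X}^*$ with $\|F_x\|_{\mathcal{X}^*}=1$ and $F_x(x)=\|x\|$ (if it is not unique, any choice is allowed, fixed once for each $g_n$). Natural Greedy Algorithm (NGA): Set $\mathcal{R}_0(f)=f$ and $V_0=\{0\}$. For $n=0,1,2,\dots$: choose $f_n\in\mathcal{F}$ with $\|\mathcal{R}_n(f_n)\|=\max_{f\in\mathcal{F}}\|\mathcal{R}_n(f)\|$; put $g_n=\mathcal{R}_n(f_n)/\|\mathcal{R}_n(f_n)\|$; choose a norming functional $F_{g_n}$; put $r_n(f)=f-F_{g_n}(f)\,g_n$, $\mathcal{R}_{n+1}=r_n\circ\mathcal{R}_n=r_n\circ r_{n-1}\circ\dots\circ r_0$, and $V_{n+1}=\operatorname{span}\{f_0,\dots,f_n\}$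 (which equals $\operatorname{span}\{g_0,\dots,g_n\}$). Any sequences produced by such choices form a realization. *)

(* Defs.v *)
From HB Require Import structures.
From mathcomp Require Import all_boot all_order all_algebra.
From mathcomp Require Import all_classical all_reals all_analysis.

Set Implicit Arguments.
Unset Strict Implicit.
Unset Printing Implicit Defensive.

Import Order.TTheory GRing.Theory Num.Theory.
Import numFieldNormedType.Exports.

Local Open Scope classical_set_scope.
Local Open Scope ring_scope.

(* The vectors [v i] may repeat and [n] may be 0, so that the span of [set0]
   is [[set 0]]. *)
Definition lin_span (R : pzRingType) (X : lmodType R) (A : set X) : set X :=
  [set x | exists (n : nat) (a : 'I_n -> R) (v : 'I_n -> X),
     (forall i, A (v i)) /\ x = \sum_(i < n) a i *: v i].

(* [U] is meant to be a linear subspace. *)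
Definition finite_dimensional (R : pzRingType) (X : lmodType R) (U : set X) :=
  exists B : set X, finite_set B /\ lin_span B = U.

(* [R^o] is [R] seen as a normed module over itself.  The supremum is that of
   a bounded set, hence meaningful, when [F] is continuous. *)
Definition dual_norm (R : realType) (X : normedModType R)
    (F : {linear X -> R^o}) : R :=
  sup [set `|F x| | x in [set x : X | `|x| <= 1]].

(* Only used for [x != 0]; this is not required here because, in a realization
   of the greedy algorithm, it follows from the infinite dimension of the span
   of the approximated set. *)
Definition norming_functional (R : realType) (X : normedModType R)
    (F : {linear X -> R^o}) (x : X) : Prop :=
  [/\ continuous F, dual_norm F = 1 & F x = `|x| ].

Definition greedy_step (R : realType) (X : normedModType R)
    (F : {linear X -> R^o}) (g : X) : X -> X :=
  fun h => h - (F h : R) *: g.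

Record NGA_realization (R : realType) (X : normedModType R) (K : set X)
    (f g : nat -> X) (F : nat -> {linear X -> R^o})
    (Res : nat -> X -> X) (V : nat -> set X) : Prop := {
  NGA_residual0 : Res 0%N = id ;
  NGA_space0 : V 0%N = [set 0] ;
  NGA_mem : forall n, K (f n) ;
  NGA_max : forall n h, K h -> `|Res n h| <= `|Res n (f n)| ;
  NGA_normalize : forall n, g n = `|Res n (f n)|^-1 *: Res n (f n) ;
  NGA_norming : forall n, norming_functional (F n) (g n) ;
  NGA_residualS : forall n, Res n.+1 = greedy_step (F n) (g n) \o Res n ;
  NGA_spaceS : forall n, V n.+1 = lin_span [set f k | k in `I_n.+1]
}.

(* Main.v *)
(** Telescoping the recursion [Res n.+1 h = Res n h - F n (Res n h) *: g n]
    shows that [h - Res n h] always lies in [V n].  Hence, were [Res n (f n)]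
    zero, maximality would make [Res n] vanish on [K], so [K] would be contained
    in [V n], contradicting infinite dimension; so each [g n] is a unit vector
    and [F n (g n) = 1].  Then [Res n.+1] takes values in the kernel of [F n] and
    kills [f n]; both properties persist, because [g m] lies in the range of
    [Res m], so that [V n] is in the kernel of [Res n].  Idempotence follows
    from [h - Res n h] being in that kernel. *)
Require Import Defs.
From HB Require Import structures.
From mathcomp Require Import all_boot all_order all_algebra.
From mathcomp Require Import all_classical all_reals all_analysis.

Set Implicit Arguments.
Unset Strict Implicit.
Unset Printing Implicit Defensive.

Import Order.TTheory GRing.Theory Num.Theory.
Import numFieldNormedType.Exports.

Local Open Scope classical_set_scope.
Local Open Scope ring_scope.

Section LinSpan.
Context {R : pzRingType} {X : lmodType R}.
Implicit Types (A B P : set X) (x y : X).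

Lemma sub_lin_span A : A `<=` lin_span A.
Proof.
move=> x Ax; exists 1%N, (fun=> 1), (fun=> x); split=> //.
by rewrite big_ord1 scale1r.
Qed.

Lemma lin_span_0 A : lin_span A 0.
Proof. by exists 0%N, (fun=> 0), (fun=> 0); split=> [[]//|]; rewrite big_ord0. Qed.

Lemma lin_span_linear A (a : R) x y :
  lin_span A x -> lin_span A y -> lin_span A (a *: x + y).
Proof.
move=> [n [b [v [Av ->]]]] [m [c [w [Aw ->]]]].
(* The two families are concatenated; only the coefficients of the first are multiplied by [a]. *)
exists (n + m)%N,
  (fun i : 'I_(n + m) => match fintype.split i with inl j => a * b j | inr j => c j end),
  (fun i : 'I_(n + m) => match fintype.split i with inl j => v j | inr j => w j end).
split=> [i|]; first by case: (fintype.split i).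
rewrite big_split_ord /= scaler_sumr; congr (_ + _); apply: eq_bigr => i _.
  by rewrite (unsplitK (inl i)) scalerA.
by rewrite (unsplitK (inr i)).
Qed.

(** Induction principle for spans, applied below with [P] another span, [[set 0]] or the kernel of a
    linear map. *)
Lemma lin_span_min A P :
  P 0 -> (forall (a : R) x y, P x -> P y -> P (a *: x + y)) ->
  A `<=` P -> lin_span A `<=` P.
Proof.
move=> P0 PL AP _ [n [a [v [Av ->]]]].
by elim/big_rec: _ => // i x _ Px; apply: PL => //; exact/AP/Av.
Qed.

Lemma lin_span_subset A B : A `<=` lin_span B -> lin_span A `<=` lin_span B.
Proof. by apply: lin_span_min; [exact: lin_span_0 | exact: lin_span_linear]. Qed.

Lemma lin_span_set0 : lin_span (@set0 X) = [set 0].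
Proof.
apply/seteqP; split=> [|_ ->]; last exact: lin_span_0.
by apply: lin_span_min => // a x y -> ->; rewrite scaler0 addr0.
Qed.

Lemma linear_fun0 (T : X -> X) : linear T -> T 0 = 0.
Proof. by move=> Tl; have := Tl (-1) 0 0; rewrite scaler0 addr0 scaleN1r addNr. Qed.

Lemma lin_span_sub_ker A (T : X -> X) :
  linear T -> A `<=` T @^-1` [set 0] -> lin_span A `<=` T @^-1` [set 0].
Proof.
move=> Tl; apply: lin_span_min => /=; first exact: linear_fun0.
by move=> a x y Tx Ty; rewrite Tl Tx Ty scaler0 addr0.
Qed.

End LinSpan.

Section NaturalGreedy.
Context {R : realType} {X : normedModType R} {K : set X}.
Context {f g : nat -> X} {F : nat -> {linear X -> R^o}}.
Context {Res : nat -> X -> X} {V : nat -> set X}.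
Context (nga : NGA_realization K f g F Res V).

Lemma NGA_residualSE n h : Res n.+1 h = Res n h - (F n (Res n h) : R) *: g n.
Proof. by rewrite (NGA_residualS nga). Qed.

(** The empty set spans [[set 0]], so the initial space obeys the same formula as the later ones. *)
Lemma NGA_spaceE n : V n = lin_span [set f k | k in `I_n].
Proof.
case: n => [|n]; last exact: (NGA_spaceS nga).
by rewrite (NGA_space0 nga) II0 image_set0 lin_span_set0.
Qed.

Lemma NGA_space_subS n : V n `<=` V n.+1.
Proof.
rewrite !NGA_spaceE; apply: lin_span_subset => _ [k kn <-].
by apply: sub_lin_span; exists k => //; exact: ltnW.
Qed.

Lemma NGA_residual_linear n : linear (Res n).
Proof.
elim: n => [|n IHn] a x y; first by rewrite (NGA_residual0 nga).
rewrite !NGA_residualSE IHn linearP /= scalerBr scalerDl scalerA.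
by rewrite opprD addrACA.
Qed.

Lemma NGA_sub_residual_space n h : V n (h - Res n h).
Proof.
elim: n h => [|n IHn] h.
  by rewrite (NGA_residual0 nga) (NGA_space0 nga) subrr.
have VS x : V n x -> V n.+1 x by exact: NGA_space_subS.
have lin a x y : V n.+1 x -> V n.+1 y -> V n.+1 (a *: x + y).
  by rewrite NGA_spaceE; exact: lin_span_linear.
have V0 : V n.+1 0 by rewrite NGA_spaceE; exact: lin_span_0.
have Vr : V n.+1 (Res n (f n)).
  (* Written as [f n - (f n - Res n (f n))], the residual is a generator of [V n.+1] minus an
     element of [V n]. *)
  rewrite -[Res n _](subKr (f n)) addrC -scaleN1r; apply: lin.
    exact/VS/IHn.
  by rewrite NGA_spaceE; apply: sub_lin_span; exists n => /=.
have Vg : V n.+1 (g n).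
  by rewrite (NGA_normalize nga) -[_ *: _]addr0; exact: lin.
by rewrite NGA_residualSE opprB addrCA; apply: lin => //; exact/VS.
Qed.

Context (K_infdim : ~ finite_dimensional (lin_span K)).

Lemma NGA_residual_neq0 n : Res n (f n) != 0.
Proof.
apply/eqP => r0; apply: K_infdim; exists [set f k | k in `I_n]; split.
  exact/finite_image/finite_II.
apply/seteqP; split; apply: lin_span_subset => x.
  by move=> [k _ <-]; apply/sub_lin_span/(NGA_mem nga).
move=> Kx; rewrite -NGA_spaceE -[x]subr0.
suff <- : Res n x = 0 by exact: NGA_sub_residual_space.
by have := NGA_max nga n Kx; rewrite r0 normr0 normr_le0 => /eqP.
Qed.

Lemma NGA_functional_direction n : F n (g n) = 1.
Proof.
have [_ _ ->] := NGA_norming nga n.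
rewrite (NGA_normalize nga) normrZ normfV normr_id mulVf // normr_eq0.
exact: NGA_residual_neq0.
Qed.

(** Induction on [m] for all [h] at once: when [k < m], [g m] is a multiple of [Res m (f m)], so the
    induction hypothesis is needed at [f m] as well as at [h]. *)
Lemma NGA_functional_residual m k h : (k < m)%N -> F k (Res m h) = 0.
Proof.
elim: m h => // m IHm h; rewrite ltnS leq_eqVlt NGA_residualSE linearB linearZ /=.
move=> /predU1P[->|km].
  (* Scaling in [R^o] is multiplication in [R]. *)
  by rewrite NGA_functional_direction [_ *: _]mulr1 subrr.
have Fg : F k (g m) = 0.
  by rewrite (NGA_normalize nga) linearZ /= IHm // scaler0.
by rewrite Fg IHm // scaler0 subr0.
Qed.

(** Step [n] subtracts exactly [Res n (f n)] from itself; later steps are linear and keep the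
    zero. *)
Lemma NGA_residual_element n k : (k < n)%N -> Res n (f k) = 0.
Proof.
elim: n => // n IHn; rewrite ltnS leq_eqVlt NGA_residualSE => /predU1P[->|kn].
  have nr0 : `|Res n (f n)| != 0 by rewrite normr_eq0 NGA_residual_neq0.
  have rE : Res n (f n) = `|Res n (f n)| *: g n.
    by rewrite (NGA_normalize nga) scalerA mulfV ?scale1r.
  have FrE : F n (Res n (f n)) = `|Res n (f n)|.
    by rewrite {1}rE linearZ /= NGA_functional_direction [_ *: _]mulr1.
  by rewrite FrE -rE subrr.
by rewrite IHn // linear0 scale0r subr0.
Qed.

Lemma NGA_residual_ker n : Res n @^-1` [set 0] = V n.
Proof.
apply/seteqP; split=> [x /= rx0|].
  by rewrite -[x]subr0 -rx0; exact: NGA_sub_residual_space.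
rewrite NGA_spaceE; apply: lin_span_sub_ker; first exact: NGA_residual_linear.
by move=> _ [k kn <-]; exact: NGA_residual_element.
Qed.

Lemma NGA_residual_idem n : Res n \o Res n = Res n.
Proof.
apply/funext => h /=.
have : (Res n @^-1` [set 0]) (h - Res n h).
  by rewrite NGA_residual_ker; exact: NGA_sub_residual_space.
(* The difference is put in the form [a *: x + y] with [a = -1], so that linearity of [Res n]
   applies. *)
by rewrite /= addrC -scaleN1r NGA_residual_linear scaleN1r addrC => /subr0_eq.
Qed.

End NaturalGreedy.

Theorem mainTheorem5 (R : realType) (X : completeNormedModType R) (K : set X)
  (K_compact : compact K)
  (K_infdim : ~ finite_dimensional (lin_span K))
  (f g : nat -> X) (F : nat -> {linear X -> R^o})
  (Res : nat -> X -> X) (V : nat -> set X)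
  (nga : NGA_realization K f g F Res V) :
  (forall (m k : nat) (h : X), (k < m)%N -> F k (Res m h) = 0) /\
  (forall n : nat,
     [/\ linear (Res n), Res n \o Res n = Res n &
         Res n @^-1` [set 0] = V n]).
Proof.
split=> [m k h|n]; first exact: (NGA_functional_residual nga).
split; first exact: (NGA_residual_linear nga).
  exact: (NGA_residual_idem nga).
exact: (NGA_residual_ker nga).
Qed.
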